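(* The metric space $(\mathsf{PDgm},d_L)$, where $d_L$ is the landscape distance, is not a length space. In fact, the bottleneck distance $d_B$ is the intrinsic metric associated to $d_L$.
   Context: Let $\mathbb{R}^2_<=\{(b,d)\in\mathbb{R}^2: b<d\}$. A persistence diagram is a finite multiset $Y=\{(b_i,d_i)\}_{i=1}^N$ of points of $\mathbb{R}^2_<$; $\mathsf{PDgm}$ is the set of all of them. For $b\le d$, $\mathrm{rank}[Y](b,d)$ is the number (with multiplicity) of $(b_i,d_i)\in Y$ with $b_i\le b\le d<d_i$. The persistence landscape of $Y$ is $\lambda^Y=(\lambda^Y_1,\lambda^Y_2,\dots)$, $\lambda^Y_k(t)=\sup\{h\ge0:\mathrm{rank}[Y](t-h,t+h)\ge k\}$ for $k\in\mathbb{N}=\{1,2,\dots\}$, $t\in\mathbb{R}$ (supremum of the empty set being $0$). The landscape distance is $d_L(Y,Y')=\|\lambda^Y-\lambda^{Y'}\|_\infty=\sup_{k,t}|\lambda^Y_k(t)-\lambda^{Y'}_k(t)|$. The bottleneck distance is $$d_B(Y,Y')=\min_{\phi:S\to S'}\max\left\{\max_{(b,d)\in S}d_\infty((b,d),\phi(b,d)),\ \max_{(b,d)\in Y\setminus S}\tfrac{d-b}{2},\ \max_{(b',d')\in Y'\setminus S'}\tfrac{d'-b'}{2}\right\},$$ the minimum being over bijections $\phi$ between sub-multisets $S\subseteq Y$ and $S'\subseteq Y'$, with $d_\infty((b,d),(b',d'))=\max\{|b-b'|,|d-d'|\}$ and maxima over empty sets equal to $0$. For a metric space $(X,d)$ and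 a continuous path $\alpha:[0,1]\to X$, $\mathrm{len}_d(\alpha)=\sup\{\sum_i d(\alpha(t_i),\alpha(t_{i+1})):0=t_0<t_1<\dots<t_{n+1}=1\}$. The intrinsic metric associated to $d$ is $\hat d(x,x')=\inf\{\mathrm{len}_d(\alpha):\alpha(0)=x,\ \alpha(1)=x'\}$, the infimum being over continuous paths $\alpha:[0,1]\to X$. $(X,d)$ is a length space if $\hat d=d$. *)

(* Defs.v *)
From HB Require Import structures.
From mathcomp Require Import all_boot all_order all_algebra finmap multiset lra.
From mathcomp Require Import all_classical all_reals all_analysis.

Set Implicit Arguments.
Unset Strict Implicit.
Unset Printing Implicit Defensive.

Import Order.TTheory GRing.Theory Num.Theory.
Import numFieldNormedType.Exports.

Local Open Scope classical_set_scope.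
Local Open Scope ring_scope.

Section LengthSpaces.
Context {R : realType} {X : metricType R}.
Implicit Types (x y : X) (a : R -> X).

(* A path on [0,1] is a function on R of which only the restriction to `[0, 1]
   is used. *)
Definition is_path x y a :=
  [/\ {within `[0, 1], continuous a}, a 0 = x & a 1 = y].

(* An s with [itv_partition 0 1 s] lists t_1 < ... < t_(n+1) = 1; the point
   t_0 = 0 is implicit. *)
Definition polygonal_length a (s : seq R) : R :=
  let t := nth 1 (0 :: s) in
  \sum_(0 <= i < size s) mdist (a (t i)) (a (t i.+1)).

Definition path_length a : \bar R :=
  ereal_sup [set (polygonal_length a s)%:E | s in itv_partition 0 1].

Definition intrinsic_dist x y : \bar R :=
  ereal_inf [set path_length a | a in is_path x y].

End LengthSpaces.

Definition length_space {R : realType} (X : metricType R) :=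
  forall x y : X, intrinsic_dist x y = (mdist x y)%:E.

Definition dgm_point (R : realType) := {p : R * R | p.1 < p.2}.

HB.instance Definition _ (R : realType) := Choice.on (dgm_point R).

Definition PDgm (R : realType) := {mset dgm_point R}%mset.

HB.instance Definition _ (R : realType) :=
  Choice.copy (PDgm R) {mset dgm_point R}%mset.

Identity Coercion mset_of_PDgm : PDgm >-> multiset_of.

Section Diagrams.
Context {R : realType}.
Implicit Types (p q : dgm_point R) (Y : PDgm R) (t h : R) (k : nat).

Definition birth p : R := (val p).1.
Definition death p : R := (val p).2.

Definition rank Y (b d : R) : nat :=
  count (fun p => [&& birth p <= b, b <= d & d < death p]) Y.

(* Only meaningful for 0 < k: then the set is bounded, and [sup set0 = 0]. *)
Definition landscape Y k t : R :=
  sup [set h | 0 <= h /\ (k <= rank Y (t - h) (t + h))%N].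

Definition landscape_dist Y1 Y2 : R :=
  sup [set r | exists k t,
    (0 < k)%N /\ r = `|landscape Y1 k t - landscape Y2 k t| ].

Definition dinfty p q : R :=
  Num.max `|birth p - birth q| `|death p - death q|.

Definition half_persistence p : R := (death p - birth p) / 2.

(* A bijection between sub-multisets S of Y1 and S' of Y2 is given by the list m
   of its pairs (x, phi x), so that S and S' are the multisets of first and
   second components. *)
Definition matching_dom (m : seq (dgm_point R * dgm_point R)) : PDgm R :=
  seq_mset (unzip1 m).
Definition matching_codom (m : seq (dgm_point R * dgm_point R)) : PDgm R :=
  seq_mset (unzip2 m).

Definition is_matching Y1 Y2 (m : seq (dgm_point R * dgm_point R)) : bool :=
  (matching_dom m `<=` Y1)%mset && (matching_codom m `<=` Y2)%mset.

Definition matching_cost Y1 Y2 (m : seq (dgm_point R * dgm_point R)) : R :=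
  Num.max (\big[Num.max/0]_(pq <- m) dinfty pq.1 pq.2)
  (Num.max
    (\big[Num.max/0]_(p <- (Y1 `\` matching_dom m)%mset) half_persistence p)
    (\big[Num.max/0]_(p <- (Y2 `\` matching_codom m)%mset) half_persistence p)).

(* The infimum is attained, see bottleneck_dist_min. *)
Definition bottleneck_dist Y1 Y2 : R :=
  inf [set matching_cost Y1 Y2 m | m in is_matching Y1 Y2].

Lemma bottleneck_dist_min Y1 Y2 :
  (exists2 m, is_matching Y1 Y2 m & bottleneck_dist Y1 Y2 = matching_cost Y1 Y2 m)
  /\ (forall m, is_matching Y1 Y2 m -> bottleneck_dist Y1 Y2 <= matching_cost Y1 Y2 m).
Proof.
set C := [set matching_cost Y1 Y2 m | m in is_matching Y1 Y2].
have C0 : C !=set0.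
  exists (matching_cost Y1 Y2 [::]); exists [::] => //=.
  by rewrite /is_matching /=; apply/andP; split; apply/msubsetP => x; rewrite mset_seqE.
have Clb : has_lbound C.
  exists 0 => _ [m _ <-]; rewrite /matching_cost le_max; apply/orP; left.
  elim/big_ind : _ => // [x y x0 _|pq _]; first by rewrite le_max x0.
  by rewrite /dinfty le_max normr_ge0.
have inseq (T : eqType) (s : seq T) (f : T -> R) : \big[Num.max/0]_(i <- s) f i \in 0 :: map f s.
  elim: s => [|x s IH]; first by rewrite big_nil mem_head.
  rewrite big_cons; case: leP => _; last by rewrite !inE eqxx orbT.
  by move: IH; rewrite !inE => /orP[->//|->]; rewrite !orbT.
pose V : seq R := 0 :: [seq dinfty p q | p <- (Y1 : seq _), q <- (Y2 : seq _)]
  ++ map half_persistence (Y1 : seq _) ++ map half_persistence (Y2 : seq _).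
have CV r : C r -> r \in V.
  move=> [m /andP[m1 m2] <-]; rewrite /matching_cost.
  have h1 := inseq _ m (fun pq => dinfty pq.1 pq.2).
  have h2 := inseq _ (Y1 `\` matching_dom m)%mset half_persistence.
  have h3 := inseq _ (Y2 `\` matching_codom m)%mset half_persistence.
  move: h1 h2 h3.
  set a := \big[_/_]_(i <- m) _; set b := \big[_/_]_(i <- _) _.
  set c := \big[_/_]_(i <- _) _ => h1 h2 h3.
  have aV : a \in V.
    move: h1; rewrite !inE => /orP[->//|/mapP[[p q] pqm ->]].
    rewrite mem_cat; apply/orP; right; apply/orP; left; apply: allpairs_f.
      by apply: (msubset_subset m1); rewrite (perm_mem (perm_eq_seq_mset _)) (map_f fst pqm).
    by apply: (msubset_subset m2); rewrite (perm_mem (perm_eq_seq_mset _)) (map_f snd pqm).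
  have bV : b \in V.
    move: h2; rewrite !inE => /orP[->//|/mapP[p pm ->]].
    rewrite !mem_cat; apply/orP; right; apply/orP; right; apply/orP; left; apply: map_f.
    exact: (msubset_subset (msubsetDl _ _) pm).
  have cV : c \in V.
    move: h3; rewrite !inE => /orP[->//|/mapP[p pm ->]].
    rewrite !mem_cat; apply/orP; right; apply/orP; right; apply/orP; right; apply: map_f.
    exact: (msubset_subset (msubsetDl _ _) pm).
  by rewrite /Num.max; do 2 case: ifP.
split; last by move=> m hm; apply: ge_inf => //; exists m.
suff [r Cr hr] : exists2 r, C r & lbound C r.
  have -> : bottleneck_dist Y1 Y2 = r.
    apply/eqP; rewrite eq_le; apply/andP; split; first exact: ge_inf.
    exact: lb_le_inf.
  by case: Cr => m hm <-; exists m.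
have : exists2 r, C r & r \in V by case: C0 => r Cr; exists r => //; exact: CV.
move: (V) CV => {inseq}W CW [r0 Cr0 r0W].
pose D := [seq r <- W | `[< C r >]].
have r0D : r0 \in D by rewrite mem_filter r0W andbT; apply/asboolP.
exists (\big[Num.min/r0]_(r <- D) r).
  by rewrite big_seq; elim/big_ind : _ => // [x y Cx Cy|x]; 
    [rewrite /Num.min; case: ifP | rewrite mem_filter => /andP[/asboolP]].
move=> r Cr; have : r \in D by rewrite mem_filter CW// andbT; apply/asboolP.
elim: D {r0D} => // x D IH; rewrite inE big_cons ge_min => /orP[/eqP->|/IH->].
  by rewrite lexx.
by rewrite orbT.
Qed.

Definition maxpers (s : seq (dgm_point R)) := \sum_(p <- s) (death p - birth p).

Lemma pers_gt0 p : 0 < death p - birth p.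
Proof. by rewrite subr_gt0 /birth /death (valP p). Qed.

Lemma maxpers_ge0 s : 0 <= maxpers s.
Proof. by apply: sumr_ge0 => p _; exact/ltW/pers_gt0. Qed.

Lemma maxpers_ge s p : p \in s -> death p - birth p <= maxpers s.
Proof.
elim: s => // q s IH; rewrite inE /maxpers big_cons => /orP[/eqP->|/IH h].
  by rewrite lerDl maxpers_ge0.
by rewrite (le_trans h)// lerDr ltW// pers_gt0.
Qed.

Lemma landscape_ub Y k t : (0 < k)%N ->
  ubound [set h | 0 <= h /\ (k <= rank Y (t - h) (t + h))%N] (maxpers Y).
Proof.
move=> k0 h [h0 kr].
have : (0 < rank Y (t - h) (t + h))%N by exact: leq_trans kr.
rewrite -has_count => /hasP[p pY /and3P[b1 _ d1]].
have := maxpers_ge pY; lra.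
Qed.

Lemma landscape_itv Y k t : (0 < k)%N -> 0 <= landscape Y k t <= maxpers Y.
Proof.
move=> k0; rewrite /landscape.
have := @landscape_ub Y k t k0.
set A := [set h | _] => ubA.
have [->|/set0P A0] := eqVneq A set0; first by rewrite sup0 lexx maxpers_ge0.
rewrite ge_sup// andbT.
have [h Ah] := A0; apply: (@le_trans _ _ h); first by case: Ah.
by apply: ub_le_sup => //; exists (maxpers Y); exact: ubA.
Qed.

Definition openrank (s : seq (dgm_point R)) (b d : R) : nat :=
  count (fun p => (birth p < b) && (d < death p)) s.

Lemma openrank_near (s : seq (dgm_point R)) (b d : R) : exists2 e, 0 < e &
  {in s, forall p, (birth p < b) && (d < death p) ->
    (birth p <= b - e) && (d + e < death p)}.
Proof.
elim: s => [|p s [e e0 IH]]; first by exists 1.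
have [/andP[pb dp]|hp] := boolP ((birth p < b) && (d < death p)); last first.
  exists e => // q; rewrite inE => /predU1P[->/(negP hp)//|]; exact: IH.
pose e' := Num.min e (Num.min (b - birth p) ((death p - d) / 2)).
have e'1 : e' <= e by rewrite ge_min lexx.
have e'2 : e' <= b - birth p by rewrite !ge_min lexx orbT.
have e'3 : e' <= (death p - d) / 2 by rewrite !ge_min lexx !orbT.
exists e'.
  by rewrite !lt_min e0 subr_gt0 pb divr_gt0 ?subr_gt0.
move=> q; rewrite inE => /predU1P[->_|qs hq]; first by apply/andP; split; lra.
by have /andP[? ?] := IH q qs hq; apply/andP; split; lra.
Qed.

Lemma landscape_gtP Y k t h : (0 < k)%N -> 0 <= h ->
  (h < landscape Y k t) = (k <= openrank Y (t - h) (t + h))%N.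
Proof.
move=> k0 h0; apply/idP/idP => [hl|kr].
  have : [set h | 0 <= h /\ (k <= rank Y (t - h) (t + h))%N] !=set0.
    apply/set0P/negP => /eqP A0; move: hl; rewrite /landscape A0 sup0; lra.
  move=> /sup_gt/(_ hl)[h' [h'0 kr] hh'].
  apply: (leq_trans kr); apply: sub_count => p /and3P[? _ ?].
  by apply/andP; split; lra.
have [e e0 he] := openrank_near Y (t - h) (t + h).
apply: (@lt_le_trans _ _ (h + e)); first lra.
apply: ub_le_sup; first by exists (maxpers Y); exact: landscape_ub.
split; first lra.
apply: (leq_trans kr).
rewrite /openrank /rank.
elim: (Y : seq _) he => //= p s IH he.
apply: leq_add; last by apply: IH => q qs; apply: he; rewrite inE qs orbT.
have [hp|//] := boolP ((birth p < t - h) && (t + h < death p)).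
have /andP[? ?] := he p (mem_head _ _) hp.
by rewrite lt0b; apply/and3P; split; lra.
Qed.

Lemma landscape_openrank Y1 Y2 :
  (forall k t, (0 < k)%N -> landscape Y1 k t = landscape Y2 k t) ->
  forall b d, b <= d -> openrank Y1 b d = openrank Y2 b d.
Proof.
move=> eqL b d bd.
have h0 : 0 <= (d - b) / 2 by lra.
have E k : (0 < k)%N -> (k <= openrank Y1 b d)%N = (k <= openrank Y2 b d)%N.
  move=> k0.
  have bE : b = (b + d) / 2 - (d - b) / 2 by lra.
  have dE : d = (b + d) / 2 + (d - b) / 2 by lra.
  have := @landscape_gtP Y1 k ((b + d) / 2) ((d - b) / 2) k0 h0.
  have := @landscape_gtP Y2 k ((b + d) / 2) ((d - b) / 2) k0 h0.
  by rewrite -bE -dE eqL// => <- <-.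
apply/eqP; rewrite eqn_leq; apply/andP; split.
- by have [->//|n0] := posnP (openrank Y1 b d); rewrite -E.
- by have [->//|n0] := posnP (openrank Y2 b d); rewrite E.
Qed.

Lemma openrank_mult (s : seq (dgm_point R)) p : exists2 e0, 0 < e0 &
  forall e, 0 < e <= e0 ->
  (openrank s (birth p + e) (death p - e) + openrank s (birth p) (death p) =
   openrank s (birth p) (death p - e) + openrank s (birth p + e) (death p)
   + count_mem p s)%N.
Proof.
elim: s => [|q s [e1 e10 IH]]; first by exists 1.
pose f (x : R) : R := if x == 0 then 1 else `|x|.
have f0 x : 0 < f x by rewrite /f; case: ifPn => //; rewrite normr_gt0.
exists (Num.min e1 (Num.min (f (birth q - birth p)) (f (death q - death p)))).
  by rewrite !lt_min e10 !f0.
move=> e /andP[e0]; rewrite !le_min => /and3P[ee1 eb ed].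
have {}IH := IH e; rewrite e0 ee1 in IH; have {}IH := IH isT.
rewrite /openrank /= in IH *.
suff : (((birth q < birth p + e)%R && (death p - e < death q)%R) +
  ((birth q < birth p)%R && (death p < death q)%R) =
  ((birth q < birth p)%R && (death p - e < death q)%R) +
  ((birth q < birth p + e)%R && (death p < death q)%R) + (q == p))%N.
  move=> H; rewrite addnACA H IH addnACA; congr (_ + _)%N; exact: addnACA.
have -> : (q == p) = (birth q == birth p) && (death q == death p).
  by rewrite -(inj_eq val_inj) /birth /death -xpair_eqE -!surjective_pairing.
move: eb ed; rewrite /f !subr_eq0.
have [bE|bN] := eqVneq (birth q) (birth p).
  rewrite bE ltxx ltrDl e0 /= => _.
  have [dE|dN] := eqVneq (death q) (death p).
    by rewrite dE ltxx gtrBl e0.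
  move=> ed.
  suff -> : (death p - e < death q) = (death p < death q) by rewrite addn0.
  move: ed; case: ltrP => [h|h]; case: ltrP => h'; lra.
move=> eb _.
suff -> : (birth q < birth p + e) = (birth q < birth p) by rewrite addn0 addnC.
move: eb; case: ltrP => [h|h]; case: ltrP => h'; lra.
Qed.

Lemma landscape_inj Y1 Y2 :
  (forall k t, (0 < k)%N -> landscape Y1 k t = landscape Y2 k t) -> Y1 = Y2.
Proof.
move=> /landscape_openrank E; apply/msetP => p.
rewrite -(count_mem_mset p Y1) -(count_mem_mset p Y2).
have [e1 e10 h1] := openrank_mult Y1 p.
have [e2 e20 h2] := openrank_mult Y2 p.
have pp := pers_gt0 p.
pose e := Num.min e1 (Num.min e2 ((death p - birth p) / 2)).
have e0 : 0 < e by rewrite !lt_min e10 e20 divr_gt0.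
have ee1 : e <= e1 by rewrite ge_min lexx.
have ee2 : e <= e2 by rewrite !ge_min lexx orbT.
have ep : e <= (death p - birth p) / 2 by rewrite !ge_min lexx !orbT.
have {h1} := h1 e; rewrite e0 ee1 => /(_ isT) h1.
have {h2} := h2 e; rewrite e0 ee2 => /(_ isT).
rewrite -!E; [|lra..].
by rewrite h1 => /addnI.
Qed.

Lemma dist_ubound Y1 Y2 : has_ubound [set r | exists k t,
    (0 < k)%N /\ r = `|landscape Y1 k t - landscape Y2 k t| ].
Proof.
exists (maxpers Y1 + maxpers Y2) => _ [k [t [k0 ->]]].
have /andP[? ?] := @landscape_itv Y1 k t k0.
have /andP[? ?] := @landscape_itv Y2 k t k0.
by rewrite ler_norml; apply/andP; split; lra.
Qed.

Lemma landscape_dist_has_sup Y1 Y2 : has_sup [set r | exists k t,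
    (0 < k)%N /\ r = `|landscape Y1 k t - landscape Y2 k t| ].
Proof.
by split; [exists `|landscape Y1 1 0 - landscape Y2 1 0|; exists 1%N, 0
          |exact: dist_ubound].
Qed.

Lemma landscape_dist_ge Y1 Y2 k t : (0 < k)%N ->
  `|landscape Y1 k t - landscape Y2 k t| <= landscape_dist Y1 Y2.
Proof. by move=> k0; apply: (ub_le_sup (dist_ubound _ _)); exists k, t. Qed.

Lemma landscape_dist_le Y1 Y2 (r : R) :
  (forall k t, (0 < k)%N -> `|landscape Y1 k t - landscape Y2 k t| <= r) ->
  landscape_dist Y1 Y2 <= r.
Proof.
move=> H; apply: ge_sup; first by case: (landscape_dist_has_sup Y1 Y2).
by move=> _ [k [t [k0 ->]]]; exact: H.
Qed.

Lemma landscape_distxx Y : landscape_dist Y Y = 0.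
Proof.
apply/eqP; rewrite eq_le; apply/andP; split.
  by apply: landscape_dist_le => k t _; rewrite subrr normr0.
by rewrite (le_trans _ (@landscape_dist_ge Y Y 1 0 _)).
Qed.

Lemma landscape_dist_eq0 Y1 Y2 : landscape_dist Y1 Y2 = 0 -> Y1 = Y2.
Proof.
move=> d0; apply: landscape_inj => k t k0.
have := landscape_dist_ge Y1 Y2 t k0.
by rewrite d0 normr_le0 subr_eq0 => /eqP.
Qed.

Lemma landscape_dist_sym Y1 Y2 : landscape_dist Y1 Y2 = landscape_dist Y2 Y1.
Proof.
by rewrite /landscape_dist; congr sup; apply/seteqP; split => _ [k [t [k0 ->]]];
  exists k, t; rewrite distrC.
Qed.

Lemma landscape_dist_triangle Y2 Y1 Y3 :
  landscape_dist Y1 Y3 <= landscape_dist Y1 Y2 + landscape_dist Y2 Y3.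
Proof.
apply: landscape_dist_le => k t k0.
rewrite (le_trans (ler_distD (landscape Y2 k t) _ _))// lerD//;
  exact: landscape_dist_ge.
Qed.

End Diagrams.

HB.instance Definition _ (R : realType) := @isMetric.Build R (PDgm R)
  (@landscape_dist R) (@landscape_distxx R) (@landscape_dist_eq0 R)
  (@landscape_dist_sym R) (@landscape_dist_triangle R).

Lemma PDgm_mdistE (R : realType) (Y1 Y2 : PDgm R) :
  mdist Y1 Y2 = landscape_dist Y1 Y2.
Proof. by []. Qed.

(* Main.v *)
Require Import Defs.
From mathcomp Require Import all_boot all_order all_algebra finmap multiset zify ring lra.
From mathcomp Require Import all_classical all_reals all_analysis.

Set Implicit Arguments.
Unset Strict Implicit.
Unset Printing Implicit Defensive.

Import Order.TTheory GRing.Theory Num.Theory.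
Import numFieldNormedType.Exports.

Local Open Scope classical_set_scope.
Local Open Scope ring_scope.

(** The bound intrinsic_dist <= bottleneck_dist comes from a straight-line path.
    Given an optimal matching of cost L, move every matched point linearly to
    its partner and every unmatched point linearly to or from the midpoint of
    its interval on the diagonal.  All coordinates move at speed at most L, so
    the path is L-Lipschitz for the landscape distance
    ([interpolate_lipschitz]) and its length is at most L.

    For the converse, note that the landscape distance does not agree with the
    bottleneck distance even in small neighbourhoods: next to a point of Y
    whose birth is moved by c, a new point of half-persistence up to about 2c
    may appear at landscape distance c.  The diagrams [one_bar]
    and [two_bars], which refute the length space property, are an instance.
    What does hold near a fixed Y is a weaker statement
    ([near_almost_matched]): if Y' is at landscape distance c from Y and c is
    small enough depending on Y and e, then there is a matching that moves points
    by at most c and leaves unmatched only points of half-persistence at most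
    c + e, a situation called [almost_matched c e].

    The point of separating c from e is that e does not accumulate along a
    chain of diagrams: a point survives by moves of total size at most the sum
    of the c's until it is dropped, and the slack e is paid only once, when it is
    dropped.  Hence [almost_matched] is transitive, adding the c's and keeping
    the same e ([almost_matched_trans]).  By continuity and a supremum argument
    on [0, 1], the endpoints of any path are joined by a finite chain of such
    steps ([path_almost_matched]), so that their bottleneck distance is at most
    a polygonal length plus e, for every e > 0.

    The local statement rests on reading the landscape distance as an erosion
    distance between the rank functions b, d |-> #{(x, y) : x < b, d < y}
    ([landscape_dist_leP]).  An alternating sum of four values of the rank
    function counts the points of a rectangle; since the rank function of Y is
    locally constant away from the finitely many coordinates of its points,
    erosion by c forces Y' to have at least as many points as Y in the closed
    box of radius c around each point of Y ([count_box]).  These points are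
    matched; a further long point of Y' would cover some t far from all
    coordinates of Y, and Y' would have too large a rank there. *)

(** * Matchings with slack *)

Section Matchings.
Context {R : realType}.
Implicit Types (p q : dgm_point R) (s : seq (dgm_point R)) (Y : PDgm R).
Implicit Types (m : seq (dgm_point R * dgm_point R)) (c e : R).

Lemma dinfty_le p q c :
  (dinfty p q <= c) = [&& birth q - c <= birth p, birth p <= birth q + c,
                          death q - c <= death p & death p <= death q + c].
Proof. by rewrite ge_max !ler_distl -!andbA. Qed.

Lemma dinfty_sym p q : dinfty p q = dinfty q p.
Proof. by rewrite /dinfty distrC (distrC (death p)). Qed.

Lemma half_persistence_dinfty p q c :
  dinfty p q <= c -> half_persistence p <= half_persistence q + c.
Proof. rewrite dinfty_le /half_persistence => /and4P[? ? ? ?]; lra. Qed.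

(** The slack e enters only in the bound on unmatched points, which is what makes
    it survive composition unchanged.  A matching is a list of pairs, and u1, u2
    list what it leaves over. *)
Definition almost_matched c e s1 s2 := exists m u1 u2,
  [/\ perm_eq s1 (unzip1 m ++ u1), perm_eq s2 (unzip2 m ++ u2),
      {in m, forall pq, dinfty pq.1 pq.2 <= c},
      {in u1, forall p, half_persistence p <= c + e} &
      {in u2, forall p, half_persistence p <= c + e}].

Lemma almost_matched_refl e s : almost_matched 0 e s s.
Proof.
exists [seq (p, p) | p <- s], [::], [::]; split => //.
- by rewrite cats0 /unzip1 -map_comp map_id.
- by rewrite cats0 /unzip2 -map_comp map_id.
- by move=> _ /mapP[p _ ->] /=; rewrite /dinfty !subrr normr0 maxxx.
Qed.

Lemma almost_matched_sym c e s1 s2 :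
  almost_matched c e s1 s2 -> almost_matched c e s2 s1.
Proof.
move=> [m [u1 [u2 [m1 m2 mc u1c u2c]]]].
exists [seq (pq.2, pq.1) | pq <- m], u2, u1; split => //.
- by rewrite /unzip1 -map_comp.
- by rewrite /unzip2 -map_comp.
- by move=> _ /mapP[pq pqm ->]; rewrite dinfty_sym mc.
Qed.

(** A pair of the first matching is continued by the second one if possible.
    When its endpoint q is unmatched on the other side, the starting point p is
    unmatched in the composite, and its half-persistence exceeds that of q, which
    is at most c2 + e, by at most c1: the slack is paid once. *)
Lemma almost_matched_trans c1 c2 e s1 s2 s3 : 0 <= c1 -> 0 <= c2 ->
  almost_matched c1 e s1 s2 -> almost_matched c2 e s2 s3 ->
  almost_matched (c1 + c2) e s1 s3.
Proof.
move=> c10 c20 [m [u1 [u2 [s1E s2E mc u1c u2c]]]].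
move=> [m' [v2 [v3 [s2E' s3E mc' v2c v3c]]]].
suff [M [w1 [w3 [w1E w3E Mc w1c w3c]]]] :
    almost_matched (c1 + c2) e (unzip1 m ++ u1) (unzip2 m' ++ v3).
  by exists M, w1, w3; split => //; [exact: perm_trans w1E|exact: perm_trans w3E].
have : perm_eq (unzip2 m ++ u2) (unzip1 m' ++ v2).
  by apply: perm_trans s2E'; rewrite perm_sym.
elim: m mc m' v2 mc' v2c {s1 s2 s3 s1E s2E s2E' s3E} => [|[p q] m IH] mc m' v2 mc' v2c.
  rewrite /= => u2E; exists [::], u1, (unzip2 m' ++ v3); split => //= r.
    by move=> /u1c; lra.
  rewrite mem_cat => /orP[/mapP[pq pqm ->]|/v3c]; last by lra.
  have : pq.1 \in u2 by rewrite (perm_mem u2E) mem_cat (map_f fst).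
  move=> /u2c; have := mc' _ pqm; rewrite dinfty_sym => /half_persistence_dinfty.
  lra.
have pqc : dinfty p q <= c1 by apply: (mc (p, q)); exact: mem_head.
have {}mc : {in m, forall pq, dinfty pq.1 pq.2 <= c1}.
  by move=> r rm; apply: mc; rewrite inE rm orbT.
rewrite /= => qE.
have : q \in unzip1 m' ++ v2 by rewrite -(perm_mem qE) mem_head.
rewrite mem_cat; have [qm _|_ /= qv] := boolP (q \in unzip1 m').
  have [[q' r] qrm /= qq'] := mapP qm; rewrite {}qq' {qm} in qE pqc.
  have m'E := perm_to_rem qrm.
  have [//||M [w1 [w3 [w1E w3E Mc w1c w3c]]]] := IH mc (rem (q', r) m') v2 _ v2c.
  - by move=> x /mem_rem; exact: mc'.
  - rewrite -(perm_cons q'); apply: (perm_trans qE).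
    by rewrite -cat_cons perm_cat2r -[_ :: _]/(unzip1 ((q', r) :: _)) perm_map.
  exists ((p, r) :: M), w1, w3; split => //=.
  - by rewrite perm_cons.
  - apply: (@perm_trans _ (unzip2 ((q', r) :: rem (q', r) m') ++ v3)).
      by rewrite perm_cat2r perm_map.
    by rewrite /= perm_cons.
  - move=> pq; rewrite inE => /orP[/eqP->|/Mc//] /=.
    move: pqc (mc' _ qrm); rewrite !dinfty_le /= => /and4P[? ? ? ?] /and4P[? ? ? ?].
    by apply/and4P; split; lra.
have v2E := perm_to_rem qv.
have [//||M [w1 [w3 [w1E w3E Mc w1c w3c]]]] := IH mc m' (rem q v2) mc'.
- by move=> x /mem_rem; exact: v2c.
- rewrite -(perm_cons q); apply: (perm_trans qE).
  rewrite perm_sym -[q :: _]/([:: q] ++ _) perm_catCA perm_cat2l /=.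
  by rewrite perm_sym.
exists M, (p :: w1), w3; split => //.
- by rewrite perm_sym -[p :: w1]/([:: p] ++ w1) perm_catCA /= perm_cons perm_sym.
- move=> x; rewrite inE => /orP[/eqP->|/w1c//].
  by have := v2c _ qv; have := half_persistence_dinfty pqc; lra.
Qed.

Lemma bottleneck_dist_le Y1 Y2 c : 0 <= c ->
  almost_matched c 0 Y1 Y2 -> bottleneck_dist Y1 Y2 <= c.
Proof.
move=> c0 [m [u1 [u2 [Y1E Y2E mc u1c u2c]]]].
have countE Y (v u : seq (dgm_point R)) : perm_eq Y (v ++ u) ->
    (seq_mset v `<=` Y)%mset /\
    {in (Y `\` seq_mset v)%mset, forall p, p \in u}.
  move=> /permP YE; split.
    apply/msubsetP => p; rewrite mset_seqE -[Y p]count_mem_mset YE count_cat.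
    exact: leq_addr.
  move=> p; rewrite in_msetB mset_seqE -[Y p]count_mem_mset YE count_cat.
  by rewrite -[X in (X < _)%N]addn0 ltn_add2l -has_count has_pred1.
have [m1 u1E] := countE _ _ _ Y1E.
have [m2 u2E] := countE _ _ _ Y2E.
have /(_ m) := (bottleneck_dist_min Y1 Y2).2.
rewrite /is_matching m1 m2 => /(_ isT) /le_trans; apply.
rewrite /matching_cost !ge_max; apply/and3P.
by split; rewrite big_seq; apply: bigmax_le => //;
  [move=> p /u1E /u1c|move=> p /u2E /u2c]; rewrite addr0.
Qed.

Lemma bottleneck_dist_matching Y1 Y2 :
  0 <= bottleneck_dist Y1 Y2 /\
  almost_matched (bottleneck_dist Y1 Y2) 0 Y1 Y2.
Proof.
have [[m /andP[m1 m2] ->] _] := bottleneck_dist_min Y1 Y2.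
have permE Y (v : seq (dgm_point R)) : (seq_mset v `<=` Y)%mset ->
    perm_eq Y (v ++ (Y `\` seq_mset v)%mset).
  move=> /msubsetP vY; apply/allP => p _ /=; apply/eqP.
  rewrite count_cat !count_mem_mset msetE2 mset_seqE subnKC//.
  by have := vY p; rewrite mset_seqE.
have bigmaxE (T : eqType) (f : T -> R) r x : x \in r ->
    f x <= \big[Num.max/0]_(y <- r) f y.
  by move=> xr; exact: le_bigmax_seq.
split; first by rewrite /matching_cost le_max bigmax_ge_id.
exists m, (Y1 `\` matching_dom m)%mset, (Y2 `\` matching_codom m)%mset.
split; [exact: permE|exact: permE|move=> x xm..]; rewrite ?addr0 !le_max.
- by rewrite (bigmaxE _ (fun pq => dinfty pq.1 pq.2) _ _ xm).
- by rewrite (bigmaxE _ half_persistence _ _ xm) ?orbT.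
- by rewrite (bigmaxE _ half_persistence _ _ xm) ?orbT.
Qed.

End Matchings.

(** * Comparison with the landscape distance near a fixed diagram *)

Section LocalMatching.
Context {R : realType}.
Implicit Types (p q : dgm_point R) (s : seq (dgm_point R)) (Y : PDgm R).
Implicit Types (b c d e t : R).

(** h < landscape Y k t means that at least k points (x, y) of Y satisfy
    x < t - h and t + h < y; letting k and t vary, a bound c on the difference
    of the landscapes becomes an inequality between ranks of intervals enlarged
    by c. *)
Lemma landscape_dist_leP Y1 Y2 c : 0 <= c ->
  landscape_dist Y1 Y2 <= c <->
  (forall b d, b <= d -> (openrank Y1 (b - c) (d + c) <= openrank Y2 b d)%N /\
                         (openrank Y2 (b - c) (d + c) <= openrank Y1 b d)%N).
Proof.
move=> c0; split => [Yc b d bd|H].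
  suff erosion Y Y' : landscape_dist Y Y' <= c ->
      (openrank Y (b - c) (d + c) <= openrank Y' b d)%N.
    by split; apply: erosion => //; rewrite landscape_dist_sym.
  move=> {}Yc; have [->//|k0] := posnP (openrank Y (b - c) (d + c)).
  pose t := (b + d) / 2; pose h := (d - b) / 2.
  have hc : h + c < landscape Y (openrank Y (b - c) (d + c)) t.
    rewrite landscape_gtP //; last by rewrite /h; lra.
    have -> : t - (h + c) = b - c by rewrite /t /h; lra.
    by have -> : t + (h + c) = d + c by rewrite /t /h; lra.
  have : h < landscape Y' (openrank Y (b - c) (d + c)) t.
    have := landscape_dist_ge Y Y' t k0; rewrite ler_norml => /andP[_]; lra.
  rewrite landscape_gtP //; last by rewrite /h; lra.
  have -> : t - h = b by rewrite /t /h; lra.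
  by have -> : t + h = d by rewrite /t /h; lra.
suff le_landscape Y Y' k t : (0 < k)%N ->
    (forall b d, b <= d -> (openrank Y (b - c) (d + c) <= openrank Y' b d)%N) ->
    landscape Y k t <= landscape Y' k t + c.
  apply: landscape_dist_le => k t k0.
  have := le_landscape Y1 Y2 k t k0 (fun b d bd => (H b d bd).1).
  have := le_landscape Y2 Y1 k t k0 (fun b d bd => (H b d bd).2).
  by rewrite ler_norml => ? ?; apply/andP; split; lra.
move=> k0 {}H; have /andP[h0 _] := landscape_itv Y' t k0.
rewrite leNgt; apply/negP; rewrite landscape_gtP //; last by lra.
set h := landscape Y' k t in h0 *; move=> kr.
suff : h < h by rewrite ltxx.
rewrite {2}/h landscape_gtP //; apply: leq_trans (H _ _ _); last by lra.
by rewrite !opprD !addrA in kr *.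
Qed.

Lemma positive_gap (W : seq R) :
  exists2 g : R, 0 < g & {in W, forall w, 0 < w -> g <= w}.
Proof.
elim: W => [|w W [g g0 gW]]; first by exists 1.
have [w0|w0] := leP w 0.
  by exists g => // x; rewrite inE => /orP[/eqP->|/gW//]; lra.
exists (Num.min g w) => [|x]; first by rewrite lt_min g0.
by rewrite inE ge_min => /orP[/eqP->|/gW h /h->//]; rewrite lexx orbT.
Qed.

(** Births and deaths share one list, so that a gap between its values is also
    a lower bound for the persistence of every point. *)
Definition coordinates s : seq R := map birth s ++ map death s.

Definition spaced g (V : seq R) :=
  {in V &, forall u v, u < v -> u + g <= v}.

Lemma spaced_exists (V : seq R) : exists2 g : R, 0 < g & spaced g V.
Proof.
have [g g0 gV] := positive_gap [seq v - u | u <- V, v <- V].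
exists g => // u v uV vV uv.
by have := gV _ (allpairs_f (fun u v => v - u) uV vV); lra.
Qed.

Lemma spaced_ltD g V u v e : spaced g V -> u \in V -> v \in V ->
  0 < e < g -> (u < v + e) = (u <= v).
Proof.
move=> sep uV vV /andP[e0 eg]; have := sep v u vV uV.
by case: (leP u v) => [uv _|vu /(_ isT) ?]; [apply/idP|apply/negbTE]; lra.
Qed.

Lemma spaced_ltBl g V u v e : spaced g V -> u \in V -> v \in V ->
  0 <= e < g -> (u < v - e) = (u < v).
Proof.
move=> sep uV vV /andP[e0 eg]; have := sep u v uV vV.
by case: (ltP u v) => [uv /(_ isT) ?|vu _]; [apply/idP|apply/negbTE]; lra.
Qed.

Lemma spaced_ltB g V u v e : spaced g V -> u \in V -> v \in V ->
  0 < e < g -> (u - e < v) = (u <= v).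
Proof. by move=> sep uV vV eg; rewrite ltrBlDr (spaced_ltD sep uV vV). Qed.

Lemma spaced_ltDl g V u v e : spaced g V -> u \in V -> v \in V ->
  0 <= e < g -> (u + e < v) = (u < v).
Proof. by move=> sep uV vV eg; rewrite -ltrBrDr (spaced_ltBl sep uV vV). Qed.

(** Pointwise comparison of indicators, in the shape needed for
    inclusion-exclusion over the corners of a rectangle. *)
Lemma count_leq (T : eqType) (s : seq T) (a1 a2 a3 b1 b2 b3 : pred T) :
  {in s, forall x, a1 x + a2 x + a3 x <= b1 x + b2 x + b3 x}%N ->
  (count a1 s + count a2 s + count a3 s <=
   count b1 s + count b2 s + count b3 s)%N.
Proof.
elim: s => //= x s IH H.
have := H x (mem_head _ _).
have : {in s, forall x, a1 x + a2 x + a3 x <= b1 x + b2 x + b3 x}%N.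
  by move=> y ys; apply: H; rewrite inE ys orbT.
by move=> /IH; lia.
Qed.

(** With p = (x, y), count the points of s2 in the rectangle
    [x - c, x + c + e) x (y - c - e, y + c] by an alternating sum of four ranks,
    and compare each rank with one of s1 by erosion.  The corners obtained for
    s1 all lie within the gap g of p, where the ranks of s1 depend only on the
    side of x and y, so their alternating sum is the multiplicity of p. *)
Lemma count_box g s1 s2 c p : 0 <= c -> 4 * c < g ->
  spaced g (coordinates s1) -> p \in s1 ->
  (forall b d, b <= d -> (openrank s1 (b - c) (d + c) <= openrank s2 b d)%N /\
                         (openrank s2 (b - c) (d + c) <= openrank s1 b d)%N) ->
  (count_mem p s1 <= count (fun q => (dinfty p q <= c)%R) s2)%N.
Proof.
move=> c0 cg sep ps1 erosion.
have birthV q : q \in s1 -> birth q \in coordinates s1.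
  by move=> qs; rewrite mem_cat (map_f birth).
have deathV q : q \in s1 -> death q \in coordinates s1.
  by move=> qs; rewrite mem_cat (map_f death) ?orbT.
have pg : birth p + g <= death p.
  by apply: sep; [exact: birthV|exact: deathV|exact: (valP p)].
(* Ranks use strict inequalities while the box is closed, so the rectangle is
   enlarged by an e too small to let in new points of s2. *)
have [e0 e00 e0P] := positive_gap [seq dinfty p q - c | q <- s2].
pose e := Num.min e0 ((g - 4 * c) / 4).
have e_gt0 : 0 < e by rewrite lt_min e00; lra.
have ee0 : e <= e0 by rewrite ge_min lexx.
have eg : e <= (g - 4 * c) / 4 by rewrite ge_min lexx orbT.
have near_e q : q \in s2 -> dinfty p q < c + e -> dinfty p q <= c.
  move=> qs2 qe; rewrite leNgt; apply/negP => cq.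
  by have := e0P _ (map_f (fun q => dinfty p q - c) qs2); lra.
pose x := birth p; pose y := death p.
have corners2 :
  (openrank s2 (x + c + e) (y - c - e) + openrank s2 (x - c) (y + c) <=
   openrank s2 (x - c) (y - c - e) + openrank s2 (x + c + e) (y + c) +
   count (fun q => (dinfty p q <= c)%R) s2)%N.
  have := @count_leq _ s2
    (fun q => (birth q < x + c + e) && (y - c - e < death q))
    (fun q => (birth q < x - c) && (y + c < death q)) pred0
    (fun q => (birth q < x - c) && (y - c - e < death q))
    (fun q => (birth q < x + c + e) && (y + c < death q))
    (fun q => dinfty p q <= c).
  rewrite count_pred0 addn0; apply => q qs2.
  have boxP : ~~ (birth q < x - c) -> birth q < x + c + e ->
      y - c - e < death q -> ~~ (y + c < death q) -> dinfty p q <= c.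
    rewrite -!leNgt => ? ? ? ?; apply: near_e => //.
    by rewrite gt_max !ltr_distl -!/x -!/y; apply/andP; split; apply/andP; split; lra.
  have b12 : birth q < x - c -> birth q < x + c + e by lra.
  have d21 : y + c < death q -> y - c - e < death q by lra.
  move: boxP b12 d21.
  case: (birth q < x - c); case: (birth q < x + c + e);
  case: (y - c - e < death q); case: (y + c < death q);
  case: (dinfty p q <= c) => //= h1 h2 h3;
  by [have := h1 isT isT isT isT|have := h2 isT|have := h3 isT].
have corners1 :
  (openrank s1 x (y - 2 * c - e) + openrank s1 (x + 2 * c + e) y +
   count_mem p s1 <=
   openrank s1 (x + e) (y - e) + openrank s1 (x - 2 * c) (y + 2 * c))%N.
  have := @count_leq _ s1
    (fun q => (birth q < x) && (y - 2 * c - e < death q))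
    (fun q => (birth q < x + 2 * c + e) && (y < death q)) (pred1 p)
    (fun q => (birth q < x + e) && (y - e < death q))
    (fun q => (birth q < x - 2 * c) && (y + 2 * c < death q)) pred0.
  rewrite count_pred0 addn0; apply => q qs1.
  have -> : pred1 p q = (birth q == x) && (death q == y).
    rewrite /= -(inj_eq val_inj) /x /y /birth /death.
    by rewrite -xpair_eqE -!surjective_pairing.
  have bq := birthV _ qs1; have bp := birthV _ ps1.
  have dq := deathV _ qs1; have dp := deathV _ ps1.
  have e'0 : 0 < 2 * c + e < g by lra.
  have eg' : 0 < e < g by lra.
  have c2g : 0 <= 2 * c < g by lra.
  rewrite -!addrA -!opprD.
  rewrite !(spaced_ltBl sep bq bp, spaced_ltD sep bq bp) //.
  rewrite !(spaced_ltB sep dp dq, spaced_ltDl sep dp dq) //.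
  rewrite -/x -/y (eq_sym (death q)).
  by case: (ltgtP (birth q) x); case: (ltgtP y (death q)).
have [] := erosion (x + c + e) (y - c - e); first by rewrite /x /y; lra.
have -> : x + c + e - c = x + e by lra.
have -> : y - c - e + c = y - e by lra.
move=> ne _.
have [] := erosion (x - c) (y + c); first by rewrite /x /y; lra.
have -> : x - c - c = x - 2 * c by lra.
have -> : y + c + c = y + 2 * c by lra.
move=> nw _.
have [] := erosion x (y - 2 * c - e); first by rewrite /x /y; lra.
have -> : y - 2 * c - e + c = y - c - e by lra.
move=> _ sw.
have [] := erosion (x + 2 * c + e) y; first by rewrite /x /y; lra.
have -> : x + 2 * c + e - c = x + c + e by lra.
move=> _ se.
lia.
Qed.

(** Hall's condition is trivial when the neighbourhoods of distinct points of s
    are disjoint: repeated points may then choose greedily. *)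
Lemma greedy_matching (T U : eqType) (near : T -> pred U) (s : seq T)
    (s' : seq U) :
  {in s, forall x, count_mem x s <= count (near x) s'}%N ->
  {in s &, forall x x' y, near x y -> near x' y -> x = x'} ->
  exists m u, [/\ unzip1 m = s, perm_eq s' (unzip2 m ++ u) &
                  {in m, forall xy, near xy.1 xy.2}].
Proof.
elim: s s' => [|x s IH] s' cnt disj; first by exists [::], s'.
have xs : x \in x :: s by exact: mem_head.
have /hasP[y ys' xy] : has (near x) s'.
  by rewrite has_count; apply: leq_trans (cnt _ xs); rewrite /= eqxx.
have s'E := perm_to_rem ys'.
have cnt' : {in s, forall z, count_mem z s <= count (near z) (rem y s')}%N.
  move=> z zs; have zxs : z \in x :: s by rewrite inE zs orbT.
  have := cnt z zxs; rewrite (permP s'E (near z)) /=.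
  have [xz|xz] := eqVneq x z; first by case: (near z y); lia.
  have [zy|_] := boolP (near z y); last by lia.
  by rewrite (disj _ _ xs zxs _ xy zy) eqxx in xz.
have disj' : {in s &, forall x x' y, near x y -> near x' y -> x = x'}.
  by move=> z z' zs z's; apply: disj; rewrite inE ?zs ?z's orbT.
have [m [u [m1 m2 mnear]]] := IH _ cnt' disj'.
exists ((x, y) :: m), u; split => /=; first by rewrite m1.
  by apply: (perm_trans s'E); rewrite perm_cons.
by move=> z; rewrite inE => /orP[/eqP->|/mnear].
Qed.

(** The two candidates for t are 5c apart.  A single coordinate is within 2c of
    at most one of them, and two distinct coordinates within 2c of them would be
    at most 9c < g apart. *)
Lemma avoid_coordinates g (V : seq R) b d c : 0 < c -> 10 * c <= g ->
  spaced g V -> b + 8 * c < d ->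
  exists2 t : R, b + c < t < d - c & {in V, forall v, 2 * c < `|t - v|}.
Proof.
move=> c0 cg sep bd; pose t i : R := (b + d) / 2 + i.
have tP i : - (5/2) * c <= i <= 5/2 * c -> b + c < t i < d - c.
  by rewrite /t => /andP[? ?]; apply/andP; split; lra.
have [tV|] := boolP (all (fun v => 2 * c < `|t (- (5/2) * c) - v|) V).
  by exists (t (- (5/2) * c)); [apply: tP; lra|exact/allP].
move=> /allPn[v vV]; rewrite -leNgt ler_distl => /andP[tv vt].
exists (t (5/2 * c)); first by apply: tP; lra.
move=> w wV; rewrite ltNge; apply/negP; rewrite ler_distl => /andP[tw wt].
rewrite /t in tv vt tw wt; move: (sep _ _ vV wV) (sep _ _ wV vV).
by case: (ltgtP v w) => [vw /(_ isT) ? _|wv _ /(_ isT) ?|vw _ _]; lra.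
Qed.

Lemma near_almost_matched Y e : 0 < e -> exists2 r : R, 0 < r &
  forall Y', landscape_dist Y Y' < r ->
    almost_matched (landscape_dist Y Y') e Y Y'.
Proof.
move=> e0; have [g g0 sep] := spaced_exists (coordinates Y).
pose r := Num.min (g / 10) (e / 4).
have r0 : 0 < r by rewrite lt_min; apply/andP; split; lra.
have rg : 10 * r <= g.
  have : r <= g / 10 by rewrite ge_min lexx.
  lra.
have re : 4 * r <= e.
  have : r <= e / 4 by rewrite ge_min lexx orbT.
  lra.
exists r => // Y' YY'; set c := landscape_dist Y Y' in YY' *.
have c0 : 0 <= c by exact: (@mdist_ge0 R (PDgm R) Y Y').
have erosion := (landscape_dist_leP Y Y' c0).1 (lexx c).
have cnt : {in (Y : seq _), forall p,
    count_mem p Y <= count (fun q => (dinfty p q <= c)%R) Y'}%N.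
  by move=> p pY; apply: (count_box c0 _ sep pY erosion); lra.
have disj : {in (Y : seq _) &, forall p p' q,
    dinfty p q <= c -> dinfty p' q <= c -> p = p'}.
  move=> p p' pY p'Y q; rewrite !dinfty_le => /and4P[? ? ? ?] /and4P[? ? ? ?].
  apply/val_inj; rewrite (surjective_pairing (val p)) (surjective_pairing (val p')).
  have inV q' : q' \in (Y : seq _) ->
      birth q' \in coordinates Y /\ death q' \in coordinates Y.
    by move=> qY; rewrite !mem_cat (map_f birth) ?(map_f death) ?orbT.
  have [bp dp] := inV _ pY; have [bp' dp'] := inV _ p'Y.
  congr pair; rewrite -/(birth _) -/(death _).
    move: (sep _ _ bp bp') (sep _ _ bp' bp).
    by case: (ltgtP (birth p) (birth p')) => // _ h1 h2;
      [have := h1 isT|have := h2 isT]; lra.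
  move: (sep _ _ dp dp') (sep _ _ dp' dp).
  by case: (ltgtP (death p) (death p')) => // _ h1 h2;
    [have := h1 isT|have := h2 isT]; lra.
have [m [u [m1 m2 mc]]] := greedy_matching cnt disj.
exists m, [::], u; split => //; first by rewrite cats0 m1.
move=> q qu; rewrite leNgt; apply/negP => qe.
have qlong : birth q + 8 * r < death q by move: qe; rewrite /half_persistence; lra.
(* The rank of Y' at (t - r, t + r) is at most that of Y at (t, t).  But all
   points of Y counted at t have partners counted at (t - r, t + r), and q is
   counted in addition. *)
have [t /andP[bt td] tV] := avoid_coordinates r0 rg sep qlong.
have := (landscape_dist_leP Y Y' (ltW r0)).1 (ltW YY') t t (lexx t).
move=> [_]; rewrite /openrank leqNgt => /negP; apply.
rewrite (permP m2) count_cat.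
have : (0 < count (fun p => (birth p < t - r)%R && (t + r < death p)%R) u)%N.
  by rewrite -has_count; apply/hasP; exists q => //; apply/andP; split; lra.
suff : (count (fun p => (birth p < t)%R && (t < death p)%R) Y <=
    count (fun p => (birth p < t - r)%R && (t + r < death p)%R) (unzip2 m))%N.
  by move=> le_m lt_u; rewrite -[X in (X < _)%N]addn0 -addnS leq_add.
rewrite -{1}m1 /unzip1 /unzip2 !count_map.
have mY : {in m, forall pq, pq.1 \in (Y : seq _)}.
  by move=> pq pqm; rewrite -m1 map_f.
elim: (m) mc mY => //= -[p p'] m' IH mc mY; apply: leq_add; last first.
  by apply: IH => x xm; [apply: mc|apply: mY]; rewrite inE xm orbT.
have pY := mY _ (mem_head _ _); have := mc _ (mem_head _ _).
rewrite /= in pY *; rewrite dinfty_le => /and4P[? ? ? ?].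
have := tV (birth p); rewrite mem_cat (map_f birth pY) => /(_ isT).
have := tV (death p); rewrite mem_cat (map_f death pY) orbT => /(_ isT).
rewrite !ltr_normr => dt bt'.
have [/andP[bp dp]|//] := boolP ((birth p < t) && (t < death p)).
rewrite lt0b; apply/andP; split.
- by case/orP: bt'; lra.
- by case/orP: dt; lra.
Qed.

End LocalMatching.

(** * Lengths of paths *)

Section PathLengths.
Context {R : realType} {X : metricType R}.
Implicit Types (a : R -> X) (s : seq R) (t u e L : R).

Lemma within_continuous_mdistP (A : set R) a :
  {within A, continuous a} <->
  (forall t, A t -> forall e, 0 < e -> exists2 r : R, 0 < r &
     forall u, A u -> `|t - u| < r -> mdist (a t) (a u) < e).
Proof.
rewrite subspace_continuousP; split => H t At.
  move=> e e0; have /cvg_ballP/(_ _ e0) := H t At.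
  move=> /nbhs_ballP[r /= r0 rP]; exists r => // u Au tu.
  by have := rP u tu Au; rewrite ballEmdist.
apply/cvg_ballP => e e0; have [r r0 rP] := H t At e e0.
apply/nbhs_ballP; exists r => // u /= tu Au.
by rewrite /= ballEmdist; apply: rP.
Qed.

Lemma polygonal_length_ge0 a s : 0 <= polygonal_length a s.
Proof. by apply: sumr_ge0 => i _; exact: mdist_ge0. Qed.

Lemma polygonal_length_rcons a s t :
  polygonal_length a (rcons s t) =
  polygonal_length a s + mdist (a (last 0 s)) (a t).
Proof.
rewrite /polygonal_length size_rcons big_nat_recr //=; congr (_ + _).
  rewrite [LHS]big_nat_cond [RHS]big_nat_cond; apply: eq_bigr => i.
  move=> /andP[/andP[_ i_s] _]; rewrite -rcons_cons !nth_rcons /= i_s.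
  by rewrite ltnS (ltnW i_s).
rewrite -rcons_cons !nth_rcons /= ltnSn ltnn eqxx.
by rewrite -[size s]/((size (0 :: s)).-1) nth_last.
Qed.

Lemma lipschitz_polygonal_length a L s :
  (forall t u, mdist (a t) (a u) <= L * `|t - u|) ->
  path <%R 0 s -> polygonal_length a s <= L * last 0 s.
Proof.
move=> aL; elim/last_ind: s => [|s t IH].
  by rewrite /polygonal_length /= big_geq // mulr0.
rewrite rcons_path last_rcons polygonal_length_rcons => /andP[/IH IHs st].
apply: (le_trans (lerD IHs (aL _ _))).
by rewrite distrC gtr0_norm ?subr_gt0 // -mulrDr addrC subrK.
Qed.

Lemma lipschitz_intrinsic_dist a L : 0 <= L ->
  (forall t u, mdist (a t) (a u) <= L * `|t - u|) ->
  (intrinsic_dist (a 0%R) (a 1%R) <= L%:E)%E.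
Proof.
move=> L0 aL; apply: ge_ereal_inf; exists (path_length a).
  exists a => //; split => //; apply/within_continuous_mdistP => t _ e e0.
  exists (e / (L + 1)) => [|u _ tu]; first by rewrite divr_gt0 //; lra.
  apply: (le_lt_trans (aL t u)); apply: (@le_lt_trans _ _ ((L + 1) * `|t - u|)).
    by rewrite ler_wpM2r //; lra.
  by rewrite mulrC -ltr_pdivlMr //; lra.
apply: ge_ereal_sup => _ [s [s_path /eqP s1] <-]; rewrite lee_fin.
by have := lipschitz_polygonal_length aL s_path; rewrite s1 mulr1.
Qed.

End PathLengths.

(** * The bottleneck distance as intrinsic distance *)

Section IntrinsicDistance.
Context {R : realType}.
Implicit Types (Y : PDgm R) (a : R -> PDgm R) (e : R).

(** The times reachable from 0 by a chain of good steps have a supremum c.  The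
    local result at the diagram a c gives a last step into c, by symmetry, and
    then a step beyond c unless c = 1. *)
Lemma path_almost_matched Y1 Y2 a e : 0 < e -> is_path Y1 Y2 a ->
  exists2 s, itv_partition 0 1 s &
    almost_matched (polygonal_length a s) e Y1 Y2.
Proof.
move=> e0 [/within_continuous_mdistP ca aY1 aY2].
pose reachable t := exists s, [/\ path <%R 0 s, last 0 s = t &
  almost_matched (polygonal_length a s) e Y1 (a t)].
suff [s [s_path s1 sM]] : reachable 1.
  by exists s; [split; rewrite ?s1|rewrite -aY2].
have step t u : reachable t -> t <= u ->
    almost_matched (mdist (a t) (a u)) e (a t) (a u) -> reachable u.
  move=> [s [s_path st sM]]; rewrite le_eqVlt => /orP[/eqP<-|tu] tuM.
    by exists s.
  exists (rcons s u); rewrite rcons_path last_rcons s_path st; split => //.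
  rewrite polygonal_length_rcons st; apply: almost_matched_trans sM tuM => //.
    exact: polygonal_length_ge0.
  exact: mdist_ge0.
pose S : set R := [set t | 0 <= t <= 1 /\ reachable t].
have S0 : S 0.
  split; first by rewrite lexx ler01.
  exists [::]; split => //; rewrite aY1 /polygonal_length big_geq //.
  exact: almost_matched_refl.
have Sub : ubound S 1 by move=> t [/andP[]].
have Ssup : has_sup S by split; [exists 0|exists 1].
pose c := sup S.
have c0 : 0 <= c by apply: ub_le_sup => //; exists 1.
have c1 : c <= 1 by apply: ge_sup => //; exists 0.
have [r r0 rP] := near_almost_matched (a c) e0.
have cI : [set` `[0, 1]] c by rewrite /= in_itv /= c0.
have [h h0 hP] := ca c cI r r0.
have [t St ct] := sup_adherent h0 Ssup.
have tc : t <= c by apply: ub_le_sup => //; exists 1.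
have [/andP[t0 t1] t_reach] := St.
have c_reach : reachable c.
  apply: (step _ _ t_reach tc); rewrite metric_sym.
  apply: almost_matched_sym; apply: rP; apply: hP.
    by rewrite /= in_itv /= t0.
  by rewrite ger0_norm ?subr_ge0 //; rewrite -/c in ct; lra.
have [<-//|cN1] := eqVneq c 1.
have {cN1}c1' : c < 1 by rewrite lt_neqAle cN1.
pose u := Num.min 1 (c + h / 2).
have cu : c < u by rewrite lt_min c1' /=; lra.
have u1 : u <= 1 by rewrite ge_min lexx.
have uh : u <= c + h / 2 by rewrite ge_min lexx orbT.
suff Su : S u.
  have : u <= c by apply: ub_le_sup => //; exists 1.
  lra.
split; first by apply/andP; split; lra.
apply: (step _ _ c_reach (ltW cu)); apply: rP; apply: hP.
  by rewrite /= in_itv /=; apply/andP; split; lra.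
by rewrite distrC ger0_norm ?subr_ge0 ?(ltW cu) //; lra.
Qed.

Lemma bottleneck_dist_le_intrinsic Y1 Y2 :
  ((bottleneck_dist Y1 Y2)%:E <= intrinsic_dist Y1 Y2)%E.
Proof.
apply: le_ereal_inf_tmp => _ [a aP <-]; apply/lee_addgt0Pr => e e0.
have [s s_part [m [u1 [u2 [Y1E Y2E mc u1c u2c]]]]] := path_almost_matched e0 aP.
have : bottleneck_dist Y1 Y2 <= polygonal_length a s + e.
  apply: bottleneck_dist_le; first by rewrite addr_ge0 ?polygonal_length_ge0 ?ltW.
  exists m, u1, u2; split => //.
  - by move=> pq /mc /le_trans; apply; rewrite lerDl ltW.
  - by move=> p /u1c; rewrite addr0.
  - by move=> p /u2c; rewrite addr0.
rewrite -lee_fin EFinD => /le_trans; apply.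
by rewrite leeD2r //; apply: ereal_sup_ubound; exists s.
Qed.

Implicit Types (x : (R * R) * (R * R)) (l : seq ((R * R) * (R * R))).

(** Degenerate points may occur in w and are dropped; they do not contribute to
    ranks, so points can move into or out of the diagonal. *)
Definition off_diagonal (w : seq (R * R)) : PDgm R :=
  seq_mset (pmap (insub : R * R -> option (dgm_point R)) w).

Lemma openrank_off_diagonal w (b d : R) : b <= d ->
  openrank (off_diagonal w) b d = count (fun z => (z.1 < b) && (d < z.2)) w.
Proof.
move=> bd; rewrite /openrank (permP (perm_eq_seq_mset _)).
elim: w => //= z w IH; case: insubP => [p _ pz|zN] /=.
  by rewrite IH /birth /death pz.
rewrite IH; case: ltP => //= zb; case: ltP => //= dz.
by case/negP: zN; lra.
Qed.

Definition interpolate t x : R * R :=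
  ((1 - t) * x.1.1 + t * x.2.1, (1 - t) * x.1.2 + t * x.2.2).

(** Ranks of the interpolated diagrams can be computed on the raw lists, where
    the points correspond one to one and corresponding points are close. *)
Lemma interpolate_lipschitz L l t u :
  {in l, forall x, `|x.1.1 - x.2.1| <= L /\ `|x.1.2 - x.2.2| <= L} -> 0 <= L ->
  landscape_dist (off_diagonal [seq interpolate t x | x <- l])
                 (off_diagonal [seq interpolate u x | x <- l]) <= L * `|t - u|.
Proof.
move=> lL L0; have c0 : 0 <= L * `|t - u| by rewrite mulr_ge0.
have lip v v' : `|v - v'| <= L ->
    `|((1 - t) * v + t * v') - ((1 - u) * v + u * v')| <= L * `|t - u|.
  move=> vL; have -> : (1 - t) * v + t * v' - ((1 - u) * v + u * v') =
    (v - v') * (u - t) by ring.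
  by rewrite normrM (distrC u) ler_wpM2r.
apply/landscape_dist_leP => // b d bd.
rewrite !openrank_off_diagonal ?count_map; [|lra..].
split; elim: l lL => //= x l IH lL; apply: leq_add;
  try (by apply: IH => y yl; apply: lL; rewrite inE yl orbT);
  have [/lip + /lip] := lL x (mem_head _ _); rewrite !ler_distl;
  move=> /andP[? ?] /andP[? ?];
  (case: ltP => //= ?; case: ltP => //= ?);
  by rewrite lt0b; apply/andP; split; lra.
Qed.

Lemma pmap_insub_val (s : seq (dgm_point R)) :
  pmap (insub : R * R -> option (dgm_point R)) [seq val p | p <- s] = s.
Proof. exact: (map_pK valK). Qed.

Definition midpoint (p : dgm_point R) : R * R :=
  ((birth p + death p) / 2, (birth p + death p) / 2).

Lemma pmap_insub_midpoint (s : seq (dgm_point R)) :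
  pmap (insub : R * R -> option (dgm_point R)) [seq midpoint p | p <- s] = [::].
Proof. by elim: s => //= p s ->; rewrite insubF //= ltxx. Qed.

Lemma intrinsic_le_bottleneck_dist Y1 Y2 :
  (intrinsic_dist Y1 Y2 <= (bottleneck_dist Y1 Y2)%:E)%E.
Proof.
have [] := bottleneck_dist_matching Y1 Y2.
set L := bottleneck_dist Y1 Y2 => L0 [m [u1 [u2 [Y1E Y2E mc u1c u2c]]]].
pose l := [seq (val pq.1, val pq.2) | pq <- m] ++
  [seq (val p, midpoint p) | p <- u1] ++ [seq (midpoint q, val q) | q <- u2].
pose a t := off_diagonal [seq interpolate t x | x <- l].
have lL : {in l, forall x, `|x.1.1 - x.2.1| <= L /\ `|x.1.2 - x.2.2| <= L}.
  move=> x; rewrite !mem_cat => /or3P[] /mapP[z zP ->] /=.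
  - by apply/andP; have := mc z zP; rewrite ge_max.
  - have := u1c z zP; have := pers_gt0 z.
    rewrite /half_persistence -/(birth z) -/(death z) !ler_norml => ? ?.
    by split; apply/andP; split; lra.
  - have := u2c z zP; have := pers_gt0 z.
    rewrite /half_persistence -/(birth z) -/(death z) !ler_norml => ? ?.
    by split; apply/andP; split; lra.
have a0 : a 0 = Y1.
  rewrite /a; have -> : [seq interpolate 0 x | x <- l] = unzip1 l.
    by apply: eq_map => -[[? ?] [? ?]]; congr pair => /=; ring.
  rewrite /off_diagonal /l /unzip1 !map_cat -!map_comp !pmap_cat.
  rewrite pmap_insub_midpoint cats0 pmap_insub_val.
  rewrite -[RHS](seq_mset_id Y1); apply/eq_seq_msetP; rewrite perm_sym.
  by rewrite (map_comp val fst) pmap_insub_val.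
have a1 : a 1 = Y2.
  rewrite /a; have -> : [seq interpolate 1 x | x <- l] = unzip2 l.
    by apply: eq_map => -[[? ?] [? ?]]; congr pair => /=; ring.
  rewrite /off_diagonal /l /unzip2 !map_cat -!map_comp !pmap_cat.
  rewrite pmap_insub_midpoint pmap_insub_val.
  rewrite -[RHS](seq_mset_id Y2); apply/eq_seq_msetP; rewrite perm_sym.
  by rewrite (map_comp val snd) pmap_insub_val.
rewrite -a0 -a1; apply: lipschitz_intrinsic_dist => // t u.
exact: interpolate_lipschitz.
Qed.

Lemma intrinsic_distE Y1 Y2 :
  intrinsic_dist Y1 Y2 = (bottleneck_dist Y1 Y2)%:E.
Proof.
apply/eqP; rewrite eq_le intrinsic_le_bottleneck_dist.
exact: bottleneck_dist_le_intrinsic.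
Qed.
End IntrinsicDistance.

(** * Failure of the length space property *)

Section NotLengthSpace.
Context {R : realType}.

(** The point (-1, 3) is hidden from the landscape of [one_bar]: an interval it
    contains, once eroded by 1, lies in (0, 10), and both points of [two_bars]
    contain an interval only inside (1, 3), whose erosion by 1 is empty.  A
    matching has to remove (-1, 3) at cost 2, or move it to (0, 10) at cost 7. *)
Definition one_bar : PDgm R := off_diagonal [:: (0, 10)].
Definition two_bars : PDgm R := off_diagonal [:: (1, 10); (-1, 3)].

Lemma landscape_dist_bars : landscape_dist one_bar two_bars <= 1.
Proof.
apply/landscape_dist_leP => // b d bd.
rewrite !openrank_off_diagonal /=; [|lra..].
by split; repeat (case: ltP => ? /=); rewrite ?addn0 //; lra.
Qed.

Lemma mem_off_diagonal (w : seq (R * R)) (p : dgm_point R) :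
  (p \in off_diagonal w) = (val p \in w).
Proof. by rewrite (perm_mem (perm_eq_seq_mset _)) mem_pmap_sub. Qed.

Lemma bottleneck_dist_bars : 2 <= bottleneck_dist one_bar two_bars.
Proof.
have [_ [m [u1 [u2 [m1 m2 mc _ u2c]]]]] :=
  bottleneck_dist_matching one_bar two_bars.
have q_bar : (-1 : R) < 3 by lra.
pose q : dgm_point R := exist (fun z : R * R => z.1 < z.2) (-1, 3) q_bar.
have : q \in (two_bars : seq _) by rewrite mem_off_diagonal !inE eqxx orbT.
rewrite (perm_mem m2) mem_cat => /orP[/mapP[[p q'] pqm /= qE]|/u2c].
  have : p \in (one_bar : seq _) by rewrite (perm_mem m1) mem_cat (map_f fst pqm).
  rewrite mem_off_diagonal inE => /eqP pE.
  have := mc _ pqm; rewrite -qE dinfty_le /birth /death pE /= => /and4P[_ _ _].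
  lra.
rewrite /half_persistence /birth /death /=; lra.
Qed.

Lemma PDgm_not_length_space : ~ length_space (PDgm R).
Proof.
move=> /(_ one_bar two_bars); rewrite intrinsic_distE PDgm_mdistE => -[].
have := landscape_dist_bars; have := bottleneck_dist_bars; lra.
Qed.

End NotLengthSpace.

Theorem corollary4p9 (R : realType) :
  ~ length_space (PDgm R) /\
  (forall Y1 Y2 : PDgm R, intrinsic_dist Y1 Y2 = (bottleneck_dist Y1 Y2)%:E).
Proof. by split; [exact: PDgm_not_length_space|exact: intrinsic_distE]. Qed.
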